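(* Let $g\ge 0$, $n\ge 1$ be integers with $2g-2+n>0$. Let $N_{g,n}(0,\dots,0)$ denote the value at $(0,\dots,0)$ of the polynomial that represents $N_{g,n}(b_1,\dots,b_n)$ when all $b_i$ are even. Then $$N_{g,n}(0,\dots,0)=\chi\left(\mathcal{M}_{g,n}\right).$$
   Context: $\mathcal{M}_{g,n}$ is the moduli space of genus $g$ curves with $n$ labeled points, and $\chi(\mathcal{M}_{g,n})$ is its orbifold Euler characteristic. Via the Penner–Harer–Mumford–Thurston cell decomposition it is computed by $$\chi(\mathcal{M}_{g,n})=\sum_{\Gamma\in\mathcal{F}at_{g,n}}\frac{(-1)^{e(\Gamma)-n}}{|Aut\,\Gamma|},$$ with the notation defined next. A fatgraph $\Gamma$ is a finite connected graph (loops and multiple edges allowed) with all vertices of valency $>2$, equipped with a cyclic ordering of the (half-)edges at each vertex. Equivalently: let $X$ be the set of oriented edges of $\Gamma$ (each edge appears twice), $\tau_1:X\to X$ the involution reversing orientation, and $\tau_0:X\to X$ the map cyclically permuting the oriented edges with a common source vertex. Then the vertices are $X_0=X/\tau_0$, the edges are $X_1=X/\tau_1$, and the boundary components are $X_2=X/\tau_2$ with $\tau_2=\tau_0\tau_1$. The genus $g$ of a fatgraph with $n=|X_2|$ boundary components is defined by $|X_0|-|X_1|+|X_2|=2-2g$. A labeled fatgraph is a fatgraph whose boundary components are labeled $1,\dots,n$. $\mathcal{F}at_{g,n}$ denotes the (finite) set of isomorphism classes of labeled fatgraphs of genus $g$ with $n$ boundary components. An automorphism of a labeled fatgraph is a permutation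 of $X$ commuting with $\tau_0$ and $\tau_1$ and acting trivially on $X_2$; $Aut\,\Gamma$ is the group of these. Let $e(\Gamma)=|X_1|$ and let $A_\Gamma$ be the $n\times e(\Gamma)$ incidence matrix that sends each edge to the sum of its two incident boundary components (if both sides of an edge lie on the same boundary component $i$, the corresponding column has the entry $2$ in row $i$). For positive integers $b_1,\dots,b_n$, write $\mathbf{b}=(b_1,\dots,b_n)$ and let $$N_\Gamma(b_1,\dots,b_n)=\#\{\mathbf{x}\in\mathbb{Z}_{>0}^{e(\Gamma)} : A_\Gamma\mathbf{x}=\mathbf{b}\},\qquad N_{g,n}(b_1,\dots,b_n)=\sum_{\Gamma\in\mathcal{F}at_{g,n}}\frac{1}{|Aut\,\Gamma|}N_\Gamma(b_1,\dots,b_n).$$ On each parity class of $(b_1,\dots,b_n)$ (fixing each $b_i$ modulo 2), $N_{g,n}$ agrees with a polynomial in $b_1^2,\dots,b_n^2$; in particular there is a unique polynomial agreeing with $N_{g,n}$ at all tuples of even positive integers. *)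

(* Defs.v *)
From HB Require Import structures.
From mathcomp Require Import all_boot all_order all_fingroup all_algebra.
From mathcomp Require Import mpoly.
From mathcomp Require Import zify.

Set Implicit Arguments.
Unset Strict Implicit.
Unset Printing Implicit Defensive.

Import GRing.Theory.
Local Open Scope ring_scope.

(* The permutation product reads from left to right, so that [t1 * t0] is the
   composite x |-> t0 (t1 x). *)
Definition boundary_perm (X : finType) (t0 t1 : {perm X}) : {perm X} :=
  (t1 * t0)%g.

(* X is the set of oriented edges.  Transitivity on X is connectedness of the
   graph; it entails that X is nonempty. *)
Definition is_fatgraph (X : finType) (t0 t1 : {perm X}) : bool :=
  [&& [forall x, t1 (t1 x) == x],
      [forall x, t1 x != x],
      [forall x, (2 < #|porbit t0 x|)%N]
    & [transitive <<[set t0; t1]>>%g, on [set: X] | 'P]].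

(* A bijection from the boundary components to 'I_n, given as a function on
   oriented edges: constant on each component, injective on components, and
   onto. *)
Definition is_labeling (X : finType) (n : nat) (t2 : {perm X})
    (l : {ffun X -> 'I_n}) : bool :=
  [forall x, forall y, (l x == l y) == (y \in porbit t2 x)]
  && [forall i, exists x, l x == i].

Record lfatgraph (X : finType) (n : nat) := LFatgraph {
  lfg_data : {perm X} * {perm X} * {ffun X -> 'I_n};
  _ : is_fatgraph lfg_data.1.1 lfg_data.1.2
      && is_labeling (boundary_perm lfg_data.1.1 lfg_data.1.2) lfg_data.2 }.

HB.instance Definition _ X n := [isSub for @lfg_data X n].
HB.instance Definition _ X n := [Finite of lfatgraph X n by <:].

Section Fatgraph.
Variables (X : finType) (n : nat).
Implicit Type G : lfatgraph X n.

Definition tau0 G : {perm X} := (lfg_data G).1.1.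
Definition tau1 G : {perm X} := (lfg_data G).1.2.
Definition tau2 G : {perm X} := boundary_perm (tau0 G) (tau1 G).
Definition lab G : {ffun X -> 'I_n} := (lfg_data G).2.

Definition vertices G : {set {set X}} := porbits (tau0 G).
Definition edges G : {set {set X}} := porbits (tau1 G).
Definition boundaries G : {set {set X}} := porbits (tau2 G).

Definition has_genus (g : nat) G : bool :=
  #|vertices G|%:Z - #|edges G|%:Z + #|boundaries G|%:Z == 2 - 2 * g%:Z.

Definition lfg_iso G H : bool :=
  [exists s : {perm X}, [forall x,
    [&& s (tau0 G x) == tau0 H (s x),
        s (tau1 G x) == tau1 H (s x)
      & lab H (s x) == lab G x]]].

Lemma lfg_iso_equiv : equivalence_rel lfg_iso.
Proof.
have refl G : lfg_iso G G.
  by apply/existsP; exists 1%g; apply/forallP=> x; rewrite !perm1 !eqxx.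
have sym G H : lfg_iso G H -> lfg_iso H G.
  case/existsP=> s /forallP sP; apply/existsP; exists (s^-1)%g.
  apply/forallP=> x; have /and3P[/eqP s0 /eqP s1 /eqP sl] := sP ((s^-1)%g x).
  rewrite permKV in s0 s1 sl.
  by rewrite -s0 -s1 !permK sl !eqxx.
have trans G H K : lfg_iso G H -> lfg_iso H K -> lfg_iso G K.
  case/existsP=> s /forallP sP /existsP[t /forallP tP].
  apply/existsP; exists (s * t)%g; apply/forallP=> x; rewrite !permM.
  have /and3P[/eqP -> /eqP -> /eqP <-] := sP x.
  exact: tP.
move=> G H K; split=> // GH; apply/idP/idP; last exact: trans.
by apply: trans; apply: sym.
Qed.

Definition lfg_aut G : {set {perm X}} :=
  [set s : {perm X} |
    [&& [forall x, s (tau0 G x) == tau0 G (s x)],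
        [forall x, s (tau1 G x) == tau1 G (s x)]
      & [forall B in boundaries G, s @: B == B]]].

(* The oriented edges x of an edge {x, tau1 x} lie on the boundary components
   on its two sides; these may coincide, giving an entry 2. *)
Definition incidence G : 'M[nat]_(n, #|edges G|) :=
  \matrix_(i, j) #|[set x in (enum_val j : {set X}) | lab G x == i]|.

(* The solutions are taken with entries at most \sum_i b_i to have a finite
   type; every solution in natural numbers is of this kind, see
   [lattice_point_bound]. *)
Definition N_fatgraph G (b : 'cV[nat]_n) : nat :=
  #|[set x : 'cV['I_(\sum_i b i ord0).+1]_#|edges G| |
      [forall j, (0 < x j ord0)%N]
      && (incidence G *m map_mx (@nat_of_ord _) x == b)]|.

Lemma lattice_point_bound G (b : 'cV[nat]_n) (x : 'cV[nat]_#|edges G|) :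
  incidence G *m x = b -> forall j, (x j ord0 < (\sum_i b i ord0).+1)%N.
Proof.
move=> <- j; rewrite ltnS.
have /imsetP[y _ Ey] : enum_val j \in edges G by exact: enum_valP.
rewrite (bigD1 (lab G y)) //= mxE (bigD1 j) //= !mxE.
set c := #|_|; suff c_gt0 : (0 < c)%N.
  apply: (@leq_trans (c * x j ord0)%N); first by rewrite leq_pmull.
  by rewrite -[X in (_ <= X)%N]addnA leq_addr.
by apply/card_gt0P; exists y; rewrite inE Ey porbit_id eqxx.
Qed.

Lemma card_boundaries G : #|boundaries G| = n.
Proof.
have /andP[_ /andP[/forallP lP /forallP sP]] := valP G.
have lE x y : (lab G x == lab G y) = (y \in porbit (tau2 G) x).
  by move/forallP: (lP x) => /(_ y)/eqP.
pose h (i : 'I_n) := [set x | lab G x == i].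
have hE x : h (lab G x) = porbit (tau2 G) x.
  by apply/setP=> y; rewrite inE eq_sym lE.
have -> : boundaries G = h @: setT.
  apply/setP=> B; apply/imsetP/imsetP => -[x _ ->].
    by exists (lab G x); rewrite ?hE.
  by have /existsP[y /eqP <-] := sP x; exists y; rewrite -?hE.
rewrite card_imset ?cardsT ?card_ord // => i j ij.
have /existsP[y yi] := sP i.
have : y \in h i by rewrite inE.
by rewrite ij inE => /eqP <-; apply/esym/eqP.
Qed.

Lemma card_oriented_edges_bound g G :
  has_genus g G -> (#|X| + 12 <= 12 * g + 6 * n)%N.
Proof.
have /andP[/and4P[/forallP t1K /forallP t1F /forallP v3 _] _] := valP G.
move=> /eqP; rewrite card_boundaries => gE.
have part (s : {perm X}) : #|X| = (\sum_(o in porbits s) #|o|)%N.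
  have /acts_sum_card_orbit : [acts <[s]>%g, on [set: X] | 'P].
    by apply/actsP=> t _ x; rewrite !inE.
  rewrite cardsT => <-; apply: eq_bigl => o.
  by apply/imsetP/imsetP=> -[x _ ->]; exists x; rewrite ?porbitE.
have vE : (3 * #|vertices G| <= #|X|)%N.
  rewrite (part (tau0 G)) mulnC -sum_nat_const; apply: leq_sum => o.
  by case/imsetP=> x _ ->; exact: v3.
have eE : (#|X| = 2 * #|edges G|)%N.
  rewrite (part (tau1 G)) mulnC -sum_nat_const; apply: eq_bigr => o.
  case/imsetP=> x _ ->; suff -> : porbit (tau1 G) x = [set x; tau1 G x].
    by rewrite cards2 eq_sym t1F.
  apply/setP=> y; rewrite !inE; apply/porbitP/orP => [[i ->]|[]/eqP->].
  - elim: i => [|i]; first by rewrite expg0 perm1 eqxx; left.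
    rewrite expgSr permM => -[]/eqP->; first by right.
    by left; apply: t1K.
  - by exists 0%N; rewrite expg0 perm1.
  - by exists 1%N; rewrite expg1.
lia.
Qed.

End Fatgraph.

(* One representative of each isomorphism class of labeled fatgraphs of genus g
   with n boundary components and with set of oriented edges 'I_m; every
   labeled fatgraph with m oriented edges is isomorphic to one on 'I_m. *)
Definition Fat (g n m : nat) : {set lfatgraph 'I_m n} :=
  let D := [set G | has_genus g G] in
  transversal (equivalence_partition (@lfg_iso 'I_m n) D) D.

(* The bound on m omits nothing, by [card_oriented_edges_bound]. *)
Definition sum_Fat (g n : nat) (F : forall m, lfatgraph 'I_m n -> rat) : rat :=
  \sum_(m < 12 * g + 6 * n) \sum_(G in Fat g n m) F m G.

Definition N_moduli (g n : nat) (b : 'cV[nat]_n) : rat :=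
  sum_Fat g (fun m (G : lfatgraph 'I_m n) =>
    (N_fatgraph G b)%:R / #|lfg_aut G|%:R).

(* The orbifold Euler characteristic of M_{g,n}, as the sum over the cells of
   its decomposition by labeled fatgraphs.  The exponent is an integer: it is
   -1 for a genus 0 fatgraph with one vertex. *)
Definition chi_moduli (g n : nat) : rat :=
  sum_Fat g (fun m (G : lfatgraph 'I_m n) =>
    (-1) ^ (#|edges G|%:Z - n%:Z) / #|lfg_aut G|%:R).

(* Main.v *)
Require Import Defs.
From mathcomp Require Import all_boot all_order all_fingroup all_algebra.
From mathcomp Require Import mpoly.
From mathcomp Require Import zify ring.

(** The proof evaluates one generating series at infinity in two ways.  Put
    S(u) = \sum_c N_moduli g (2 c) u^(c_1 + .. + c_n), the sum being over the
    tuples c of positive integers.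

    On the one hand N_moduli g (2 c) = p(2 c), so that S is a combination of
    products of the series \sum_(t > 0) t^k u^t.  Each of these is a rational
    function of u that is regular at infinity; for k = 0 it is u / (1 - u), with
    value -1, and each further power of t is produced by the operator u d/du,
    which annihilates the value at infinity.  Only the constant term of p
    survives, and S(oo) = (-1)^n p(0) ([lattice_value_polynomial]).

    On the other hand the boundary lengths A_G x of a fatgraph G with edge
    lengths x add up to twice the sum of the x_j, because an edge has two sides.
    So G contributes to S, up to the factor 1/|Aut G|, the sum of u^(\sum_j x_j)
    over the positive integral x for which A_G x is even
    ([N_fatgraph_series]).  This condition depends only on the parities of the
    x_j, and for a fixed parity vector the sum is a product over the edges of
    u / (1 - u^2) for x_j odd and u^2 / (1 - u^2) for x_j even.  At infinity
    these are 0 and -1, so that only the parity vector 0 counts, and G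
    contributes (-1)^e(G) ([lattice_value_parity]).

    Comparison gives p(0) = \sum_G (-1)^(e(G) - n) / |Aut G|.  Summing over all
    boundary lengths at once is essential: for fixed boundary lengths the
    polytope of a single G may be empty or have a dimension other than e(G) - n,
    so there is no equality graph by graph. *)

Set Implicit Arguments.
Unset Strict Implicit.
Unset Printing Implicit Defensive.

Import GRing.Theory.
Local Open Scope ring_scope.

(** * Value at infinity of a rational power series *)

Section ValueAtInfinity.
Variable R : fieldType.
Implicit Types (P Q N D : {poly R}) (F G H : nat -> {poly R}) (L M : R).

Lemma dvd_XnP K P : reflect (forall k, (k < K)%N -> P`_k = 0) ('X^K %| P).
Proof.
apply: (iffP idP) => [/dvdpP[Q ->] k kK | P0].
  by rewrite coefMXn kK.
rewrite -(poly_take_drop K P) dvdp_addl ?dvdp_mulIr //.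
suff -> : take_poly K P = 0 by rewrite dvdp0.
by apply/polyP=> k; rewrite coef_take_poly coef0; case: ifP => // /P0.
Qed.

Lemma coefM_top a b P Q : (size P <= a.+1)%N -> (size Q <= b.+1)%N ->
  (P * Q)`_(a + b) = P`_a * Q`_b.
Proof.
move=> szP szQ; have a_lt : (a < (a + b).+1)%N by rewrite ltnS leq_addr.
rewrite coefM (bigD1 (Ordinal a_lt)) //= addKn big1 ?addr0 // => i /eqP i_neq.
have [a_lti | i_lta | aE] := ltngtP a i.
- by rewrite nth_default ?mul0r // (leq_trans szP).
- by rewrite (nth_default 0 (s := Q)) ?mulr0 //; apply: leq_trans szQ _; lia.
- by case: i_neq; apply: val_inj.
Qed.

Lemma size_mul_top a b P Q : (size P <= a.+1)%N -> (size Q <= b.+1)%N ->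
  (size (P * Q)%R <= (a + b).+1)%N.
Proof. by move=> szP szQ; have := size_polyMleq P Q; lia. Qed.

(** A power series in u is represented by any sequence F of polynomials such
    that F K agrees with it below degree K; then F converges to the rational
    function N / D.  With both degrees at most d and D of degree exactly d, the
    quotient of the coefficients of index d is the value of N / D at infinity. *)
Definition value_at_infinity F L := exists d N D,
  [/\ (size N <= d.+1)%N, (size D <= d.+1)%N, D`_d != 0, N`_d = L * D`_d
    & forall K, 'X^K %| D * F K - N].

(** Two fractions for the same series satisfy D' N = D N', since the difference
    is divisible by every power of 'X; then compare top coefficients. *)
Lemma value_at_infinity_unique F L M :
  value_at_infinity F L -> value_at_infinity F M -> L = M.
Proof.
case=> [d [N [D [szN szD Dd Nd FD]]]] [e [N' [D' [szN' szD' De Ne FD']]]].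
have eqND : D' * N = D * N'.
  apply/polyP=> k; apply/eqP; rewrite -subr_eq0 -coefB; apply/eqP.
  apply: (elimT (dvd_XnP k.+1 _)) => //.
  have -> : D' * N - D * N' = D * (D' * F k.+1 - N') - D' * (D * F k.+1 - N).
    by ring.
  by rewrite dvdp_sub ?dvdp_mull.
have /(congr1 (fun P : {poly R} => P`_(d + e))) := eqND.
rewrite {1}addnC (coefM_top szD' szN) (coefM_top szD szN') Nd Ne => eqLM.
apply: (mulIf (mulf_neq0 Dd De)).
by transitivity (D'`_e * (L * D`_d)); [ring | rewrite eqLM; ring].
Qed.

Lemma eq_value_at_infinity F G L : (forall K, 'X^K %| F K - G K) ->
  value_at_infinity F L -> value_at_infinity G L.
Proof.
move=> FG [d [N [D [szN szD Dd Nd FD]]]]; exists d, N, D; split=> // K.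
have -> : D * G K - N = (D * F K - N) - D * (F K - G K) by ring.
by rewrite dvdp_sub ?dvdp_mull.
Qed.

Lemma value_at_infinityC c : value_at_infinity (fun _ => c%:P) c.
Proof.
exists 0%N, c%:P, 1; rewrite size_polyC size_poly1 !coefE mulr1 oner_neq0.
by split=> // [|K]; [case: (c == 0) | rewrite mul1r subrr dvdp0].
Qed.

Lemma value_at_infinityD F G L M :
  value_at_infinity F L -> value_at_infinity G M ->
  value_at_infinity (fun K => F K + G K) (L + M).
Proof.
case=> [d [N [D [szN szD Dd Nd FD]]]] [e [N' [D' [szN' szD' De Ne FD']]]].
exists (d + e)%N, (N * D' + D * N'), (D * D'); split.
- by apply: leq_trans (size_polyD _ _) _; rewrite geq_max !size_mul_top.
- exact: size_mul_top.
- by rewrite coefM_top // mulf_neq0.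
- by rewrite coefD !coefM_top // Nd Ne; ring.
- move=> K; have -> : D * D' * (F K + G K) - (N * D' + D * N') =
    D' * (D * F K - N) + D * (D' * G K - N') by ring.
  by rewrite dvdp_add ?dvdp_mull.
Qed.

Lemma value_at_infinityM F G L M :
  value_at_infinity F L -> value_at_infinity G M ->
  value_at_infinity (fun K => F K * G K) (L * M).
Proof.
case=> [d [N [D [szN szD Dd Nd FD]]]] [e [N' [D' [szN' szD' De Ne FD']]]].
exists (d + e)%N, (N * N'), (D * D'); split.
- exact: size_mul_top.
- exact: size_mul_top.
- by rewrite coefM_top // mulf_neq0.
- by rewrite !coefM_top // Nd Ne; ring.
- move=> K; have -> : D * D' * (F K * G K) - N * N' =
    (D' * G K) * (D * F K - N) + N * (D' * G K - N') by ring.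
  by rewrite dvdp_add ?dvdp_mull.
Qed.

Lemma value_at_infinityZ c F L :
  value_at_infinity F L -> value_at_infinity (fun K => c *: F K) (c * L).
Proof.
move=> FL; apply: eq_value_at_infinity (value_at_infinityM (value_at_infinityC c) FL) => K.
by rewrite mul_polyC subrr dvdp0.
Qed.

Lemma value_at_infinity_sum (I : Type) (r : seq I) (P : pred I)
    (F : I -> nat -> {poly R}) (L : I -> R) :
  (forall i, P i -> value_at_infinity (F i) (L i)) ->
  value_at_infinity (fun K => \sum_(i <- r | P i) F i K)
    (\sum_(i <- r | P i) L i).
Proof.
move=> FL; elim: r => [|i r IHr].
  rewrite big_nil; apply: eq_value_at_infinity (value_at_infinityC 0) => K.
  by rewrite big_nil subrr dvdp0.
rewrite big_cons; case: ifP => Pi.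
  apply: eq_value_at_infinity (value_at_infinityD (FL i Pi) IHr) => K.
  by rewrite big_cons Pi subrr dvdp0.
by apply: eq_value_at_infinity IHr => K; rewrite big_cons Pi subrr dvdp0.
Qed.

Lemma value_at_infinity_prod (I : Type) (r : seq I)
    (F : I -> nat -> {poly R}) (L : I -> R) :
  (forall i, value_at_infinity (F i) (L i)) ->
  value_at_infinity (fun K => \prod_(i <- r) F i K) (\prod_(i <- r) L i).
Proof.
move=> FL; elim: r => [|i r IHr].
  rewrite big_nil; apply: eq_value_at_infinity (value_at_infinityC 1) => K.
  by rewrite big_nil subrr dvdp0.
rewrite big_cons.
apply: eq_value_at_infinity (value_at_infinityM (FL i) IHr) => K.
by rewrite big_cons subrr dvdp0.
Qed.

(** If N / D is regular at infinity, the numerator u (N' D - N D') of the image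
    of N / D under u d/du has coefficient d N_d D_d - N_d d D_d = 0 in degree
    2 d. *)
Lemma value_at_infinity_Xderiv F L : value_at_infinity F L ->
  value_at_infinity (fun K => 'X * (F K)^`()) 0.
Proof.
case=> [d [N [D [szN szD Dd Nd FD]]]].
have sz_Xderiv P : (size P <= d.+1)%N -> (size ('X * P^`())%R <= d.+1)%N.
  move=> szP; apply/leq_sizeP=> j dj; rewrite coefXM.
  case: j dj => //= j dj.
  by rewrite coef_deriv nth_default ?mul0rn // (leq_trans szP).
have top_Xderiv P : ('X * P^`())`_d = P`_d *+ d.
  by rewrite coefXM; case: d {szN szD Dd Nd sz_Xderiv} => //= d; rewrite coef_deriv.
exists (d + d)%N, (D * ('X * N^`()) - N * ('X * D^`())), (D * D); split.
- apply: leq_trans (size_polyD _ _) _.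
  by rewrite size_polyN geq_max !size_mul_top ?sz_Xderiv.
- exact: size_mul_top.
- by rewrite coefM_top // mulf_neq0.
- rewrite coefB !coefM_top ?sz_Xderiv // !top_Xderiv Nd.
  by rewrite -[_ *+ d]mulr_natr -[_ *+ d]mulr_natr; ring.
(* Differentiating D F K - N = Q 'X^K lowers the precision to 'X^(K - 1); the
   factor 'X restores it. *)
- move=> K; have [Q E] := dvdpP _ _ (FD K).
  have dE : 'X * (D^`() * F K + D * (F K)^`() - N^`()) =
      'X * (Q^`() * 'X^K + Q * ('X^K)^`()).
    by rewrite -!derivM -derivB E.
  have XdX : 'X * ('X^K)^`() = 'X^K *+ K :> {poly R}.
    by rewrite derivXn mulrnAr; case: K {FD E dE} => [|K]; rewrite ?mulr0n -?exprS.
  have -> : D * D * ('X * (F K)^`()) - (D * ('X * N^`()) - N * ('X * D^`())) =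
    D * ('X * (D^`() * F K + D * (F K)^`() - N^`())) -
      'X * D^`() * (D * F K - N) by ring.
  rewrite dE E mulrDr (mulrCA _ Q) XdX.
  apply: dvdp_sub; last by rewrite mulrA dvdp_mulIr.
  rewrite -mulr_natr.
  have -> : D * ('X * (Q^`() * 'X^K) + Q * ('X^K * K%:R)) =
    D * ('X * Q^`() + Q * K%:R) * 'X^K by ring.
  exact: dvdp_mulIr.
Qed.

(** The series are u / (1 - u^2) for odd exponents and u^2 / (1 - u^2) for
    positive even ones. *)
Lemma value_at_infinity_parity b : value_at_infinity
  (fun K => \sum_(t < K) ((0 < t)%N && (odd t == b))%:R *: 'X^t)
  (if b then 0 else -1).
Proof.
exists 2%N, (if b then 'X else 'X^2), (1 - 'X^2).
have DE : (1 - 'X^2 : {poly R}) = - ('X^2 - 1%:P) by rewrite opprB.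
split.
- by case: b; rewrite ?size_polyX ?size_polyXn.
- by rewrite DE size_polyN size_XnsubC.
- by rewrite !coefE sub0r oppr_eq0 oner_neq0.
- by case: b; rewrite !coefE /= ?mul0r // sub0r mulN1r opprK.
move=> K; apply/dvd_XnP=> k kK; rewrite mulrBl mul1r !coefB coefXnM.
have cE j : (j < K)%N ->
    (\sum_(t < K) ((0 < t)%N && (odd t == b))%:R *: 'X^t : {poly R})`_j =
    ((0 < j)%N && (odd j == b))%:R.
  move=> jK; rewrite coef_sum (bigD1 (Ordinal jK)) //= coefZ coefXn eqxx mulr1.
  rewrite big1 ?addr0 // => i /eqP i_j; rewrite coefZ coefXn.
  by case: (j =P i) => [ji|_]; [case: i_j; apply: val_inj | rewrite mulr0].
rewrite cE //; case: k kK => [|[|k]] kK /=.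
- by case: b {cE}; rewrite !coefE /= !subr0.
- by case: b {cE}; rewrite !coefE /= !subr0 ?subrr.
rewrite cE ?subSS ?subn0; last by lia.
case: k kK => [|k] kK; first by case: b {cE}; rewrite !coefE /= ?subr0 ?subrr.
by case: b {cE}; rewrite !coefE /= negbK !subrr ?subr0.
Qed.

(** For m = 0 add the odd and the even part; the operator u d/du passes from m
    to m + 1. *)
Lemma value_at_infinity_exp m : value_at_infinity
  (fun K => \sum_(t < K) ((0 < t)%N%:R * t%:R ^+ m) *: 'X^t)
  (if m == 0%N then -1 else 0).
Proof.
elim: m => [|m IHm] /=.
  have := value_at_infinityD (value_at_infinity_parity true)
    (value_at_infinity_parity false).
  rewrite add0r; apply: eq_value_at_infinity => K.
  rewrite -big_split -sumrB /= big1 ?dvdp0 // => t _.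
  rewrite expr0 mulr1 -scalerDl -scalerBl; apply/eqP; rewrite scaler_eq0.
  by case: (odd t); case: (0 < t)%N; rewrite /= ?addr0 ?add0r ?oppr0 ?subrr eqxx.
apply: eq_value_at_infinity (value_at_infinity_Xderiv IHm) => K.
rewrite raddf_sum mulr_sumr -sumrB big1 ?dvdp0 // => t _.
rewrite /= derivZ derivXn -scalerAr mulrnAr; apply/eqP; rewrite subr_eq0.
case: (t : nat) => [|s]; first by rewrite !mul0r !scale0r.
by rewrite -exprS !mul1r -scaler_nat scalerA -exprSr.
Qed.

End ValueAtInfinity.

(** * Generating series over lattice points of an orthant *)

Section LatticeSums.
Variables (R : fieldType) (I : finType).
Implicit Types (w : (I -> nat) -> R) (K : nat).

Definition lattice_sum w K : {poly R} :=
  \sum_(f : {ffun I -> 'I_K}) w (fun i => f i) *: 'X^(\sum_i f i).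

Lemma coef_lattice_sum w K k : (lattice_sum w K)`_k =
  \sum_(f : {ffun I -> 'I_K} | (\sum_i f i)%N == k) w (fun i => f i).
Proof. by rewrite coef_sumMXn. Qed.

Lemma lattice_sum_prod (u : I -> nat -> R) K :
  lattice_sum (fun f => \prod_i u i (f i)) K =
    \prod_i \sum_(t < K) u i t *: 'X^t.
Proof.
rewrite bigA_distr_bigA; apply: eq_bigr => f _.
by rewrite scaler_prod expr_sum.
Qed.

Lemma eq_lattice_sum w w' K : w =1 w' -> lattice_sum w K = lattice_sum w' K.
Proof. by move=> ww'; apply: eq_bigr => f _; rewrite ww'. Qed.

Lemma lattice_sum_sum (T : Type) (r : seq T) (P : pred T) (c : T -> R)
    (w : T -> (I -> nat) -> R) K :
  lattice_sum (fun f => \sum_(j <- r | P j) c j * w j f) K =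
    \sum_(j <- r | P j) c j *: lattice_sum (w j) K.
Proof.
under [RHS]eq_bigr do rewrite scaler_sumr.
rewrite exchange_big; apply: eq_bigr => f _; rewrite scaler_suml.
by apply: eq_bigr => j _; rewrite scalerA.
Qed.

Lemma prod_natr_bool (b : I -> bool) :
  \prod_i (b i)%:R = [forall i, b i]%:R :> R.
Proof.
case: (boolP [forall i, b i]) => [/forallP b1 | /forallPn[i /negPf bi]].
  by rewrite big1 // => i _; rewrite b1.
by rewrite (bigD1 i) //= bi mul0r.
Qed.

Definition parities (f : I -> nat) : {ffun I -> bool} := [ffun i => odd (f i)].

(** Split the points according to their parities y.  Each part is a product of
    one-variable series, and its value at infinity has a factor 0 for each odd
    coordinate; so only y = 0 contributes, with value -1 for each coordinate. *)
Lemma lattice_value_parity (Q : pred {ffun I -> bool}) : Q [ffun => false] ->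
  value_at_infinity
    (lattice_sum (fun f => ([forall i, (0 < f i)%N] && Q (parities f))%:R))
    ((-1) ^+ #|I|).
Proof.
move=> Q0; pose u (b : bool) (t : nat) := ((0 < t)%N && (odd t == b))%:R : R.
pose L (b : bool) : R := if b then 0 else -1.
have -> : (-1) ^+ #|I| = \sum_y (Q y)%:R * \prod_i L (y i).
  rewrite (bigD1 [ffun => false]) //= Q0 mul1r.
  under eq_bigr do rewrite ffunE.
  rewrite prodr_const big1 ?addr0 // => y y_neq0.
  have [i yi] : exists i, y i.
    apply/existsP; apply: contraR y_neq0 => /existsPn y0.
    by apply/eqP/ffunP=> i; rewrite ffunE; apply/negbTE/y0.
  by rewrite (bigD1 i) //= yi mul0r mulr0.
have sumE K : \sum_(y : {ffun I -> bool})
      (Q y)%:R *: \prod_i \sum_(t < K) u (y i) t *: 'X^t =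
    lattice_sum (fun f => ([forall i, (0 < f i)%N] && Q (parities f))%:R) K.
  under eq_bigr => y _ do rewrite -(lattice_sum_prod (fun i => u (y i))).
  rewrite -lattice_sum_sum; apply: eq_lattice_sum => f.
  under eq_bigr do rewrite prod_natr_bool.
  have posE (y : {ffun I -> bool}) : [forall i, (0 < f i)%N && (odd (f i) == y i)] =
      [forall i, (0 < f i)%N] && (y == parities f).
    apply/forallP/andP=> [fy | [/forallP f_gt0 /eqP-> i]].
      split; first by apply/forallP=> i; case/andP: (fy i).
      by apply/eqP/ffunP=> i; rewrite ffunE; have /andP[_ /eqP] := fy i.
    by rewrite f_gt0 ffunE eqxx.
  rewrite (bigD1 (parities f)) //= posE eqxx andbT -natrM mulnb andbC.
  by rewrite big1 ?addr0 // => y /negPf y_neq; rewrite posE y_neq andbF mulr0.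
apply: (eq_value_at_infinity (F := fun K => \sum_(y : {ffun I -> bool})
    (Q y)%:R *: \prod_i \sum_(t < K) u (y i) t *: 'X^t)) => [K |].
  by rewrite sumE subrr dvdp0.
apply: value_at_infinity_sum => y _.
apply: value_at_infinityZ; apply: value_at_infinity_prod => i.
exact: value_at_infinity_parity.
Qed.

End LatticeSums.

(** By linearity p can be taken to be a monomial, and then the series is a
    product; the value of the factor with exponent k is - 0 ^+ k, which is
    minus the value of the k-th power at 0. *)
Lemma lattice_value_polynomial (R : fieldType) n (p : {mpoly R[n]}) :
  value_at_infinity
    (lattice_sum (fun c : 'I_n -> nat =>
       [forall i, (0 < c i)%N]%:R * p.@[fun i => (c i).*2%:R]))
    ((-1) ^+ n * p.@[fun _ => 0]).
Proof.
pose u k t := (0 < t)%N%:R * t.*2%:R ^+ k : R.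
have u_value k :
    value_at_infinity (fun K => \sum_(t < K) u k t *: 'X^t) (- 0 ^+ k).
  have -> : - 0 ^+ k = 2 ^+ k * (if k == 0 then -1 else 0) :> R.
    by rewrite expr0n; case: k => [|k] /=; rewrite ?mul1r ?mulr0 ?oppr0.
  apply: eq_value_at_infinity
    (value_at_infinityZ _ (value_at_infinity_exp R k)) => K.
  rewrite scaler_sumr -sumrB big1 ?dvdp0 // => t _; apply/eqP.
  by rewrite subr_eq0 scalerA /u -mul2n natrM exprMn mulrCA.
have -> : (-1) ^+ n * p.@[fun _ => 0] =
    \sum_(m <- msupp p) p@_m * \prod_i (- 0 ^+ m i).
  rewrite mevalE mulr_sumr; apply: eq_bigr => m _.
  by rewrite prodrN cardE size_enum_ord mulrCA.
apply: (eq_value_at_infinity (F := fun K => \sum_(m <- msupp p)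
    p@_m *: \prod_i \sum_(t < K) u (m i) t *: 'X^t)) => [K |]; last first.
  apply: value_at_infinity_sum => m _; apply: value_at_infinityZ; apply: value_at_infinity_prod => i.
  exact: u_value.
under eq_bigr => m _ do rewrite -(lattice_sum_prod (fun i => u (m i))).
rewrite -lattice_sum_sum (eq_lattice_sum _ (w' := (fun c : 'I_n -> nat =>
       [forall i, (0 < c i)%N]%:R * p.@[fun i => (c i).*2%:R]))) ?subrr ?dvdp0 //.
move=> c; rewrite mevalE mulr_sumr; apply: eq_bigr => m _.
by rewrite big_split prod_natr_bool mulrCA.
Qed.

(** * Edge lengths and boundary lengths of a fatgraph *)

Section Perimeters.
Variables (X : finType) (n : nat) (G : lfatgraph X n).
Let edge_of := 'I_#|edges G|.
Implicit Types (x : edge_of -> nat) (j : edge_of) (i : 'I_n) (b : 'cV[nat]_n).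

Definition perimeter x i : nat := (\sum_j incidence G i j * x j)%N.

Lemma card_edge j : #|(enum_val j : {set X})| = 2%N.
Proof.
have /andP[/and4P[/forallP t1K /forallP t1F _ _] _] := valP G.
have /imsetP[y _ ->] : enum_val j \in edges G by exact: enum_valP.
suff -> : porbit (tau1 G) y = [set y; tau1 G y] by rewrite cards2 eq_sym t1F.
apply/setP=> z; rewrite !inE; apply/idP/orP => [/porbitP[k ->] | []/eqP->].
- elim: k => [|k]; first by rewrite expg0 perm1 eqxx; left.
  rewrite expgSr permM => -[]/eqP->; first by right.
  by left; apply: t1K.
- exact: porbit_id.
- by rewrite -[tau1 G in X in X \in _]expg1 mem_porbit.
Qed.

Lemma sum_incidence j : (\sum_i incidence G i j = 2)%N.
Proof.
apply/esym; rewrite -{1}(card_edge j) -sum1_card (partition_big (lab G) xpredT) //=.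
by apply: eq_bigr => i _; rewrite mxE -sum1_card; apply: eq_bigl => y; rewrite inE.
Qed.

Lemma sum_perimeter x : (\sum_i perimeter x i = (\sum_j x j).*2)%N.
Proof.
rewrite exchange_big -mul2n big_distrr /=; apply: eq_bigr => j _.
by rewrite -big_distrl sum_incidence.
Qed.

Lemma perimeter_gt0 x i : (forall j, 0 < x j)%N -> (0 < perimeter x i)%N.
Proof.
move=> x_gt0; have /andP[_ /andP[_ /forallP/(_ i)/existsP[y /eqP yi]]] := valP G.
have ey : porbit (tau1 G) y \in edges G by exact: imset_f.
pose j := enum_rank_in ey (porbit (tau1 G) y).
rewrite /perimeter (bigD1 j) //= addn_gt0 muln_gt0 x_gt0 andbT mxE.
apply/orP; left; apply/card_gt0P; exists y.
by rewrite inE enum_rankK_in // porbit_id /= yi.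
Qed.

Definition is_solution (b : 'cV[nat]_n) x : bool :=
  [forall j, (0 < x j)%N] && [forall i, perimeter x i == b i ord0].

Lemma eq_is_solution b x y : x =1 y -> is_solution b x = is_solution b y.
Proof.
move=> xy; rewrite /is_solution /perimeter.
congr (_ && _); apply: eq_forallb => i; rewrite ?xy //.
by under eq_bigr do rewrite xy.
Qed.

(** Since b has sum 2 \sum_j x_j, every solution has entries below K, and the
    bound on the entries can be changed to one that does not depend on b. *)
Lemma N_fatgraphE b K : (\sum_i b i ord0 < K.*2)%N ->
  N_fatgraph G b = #|[set x : {ffun edge_of -> 'I_K} | is_solution b (fun j => x j)]|.
Proof.
case: K => [|K] // bK.
have bounded x j : is_solution b x ->
    (x j < K.+1)%N /\ (x j < (\sum_i b i ord0).+1)%N.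
  case/andP=> _ /forallP xb.
  have xs : (\sum_i b i ord0 = (\sum_j x j).*2)%N.
    by rewrite -sum_perimeter; apply: eq_bigr => i _; rewrite (eqP (xb i)).
  have : (x j <= \sum_j x j)%N by rewrite (bigD1 j) //= leq_addr.
  by lia.
rewrite /N_fatgraph; set A := (X in #|X| = _).
have AE (x : 'cV_#|edges G|) : (x \in A) = is_solution b (fun j => x j ord0).
  have mulE i : (incidence G *m map_mx (@nat_of_ord _) x) i ord0 =
      perimeter (fun j => x j ord0) i.
    by rewrite mxE; apply: eq_bigr => j _; rewrite !mxE.
  rewrite inE; congr (_ && _); apply/eqP/forallP => [/matrixP xb i | xb].
    by rewrite -mulE xb.
  by apply/matrixP=> i k; rewrite (ord1 k) mulE; apply/eqP.
set B : {set {ffun edge_of -> 'I_K.+1}} := [set _ | _].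
pose f (x : 'cV['I_(\sum_i b i ord0).+1]_#|edges G|) :=
  [ffun j => inord (x j ord0)] : {ffun edge_of -> 'I_K.+1}.
have fE (x : 'cV_#|edges G|) j : x \in A -> f x j = x j ord0 :> nat.
  by rewrite AE ffunE => /(bounded _ j)[xK _]; rewrite inordK.
have -> : B = f @: A.
  apply/setP=> y; rewrite inE; apply/idP/imsetP => [yb | [x xA ->]].
    pose x : 'cV['I_(\sum_i b i ord0).+1]_#|edges G| := \col_j inord (y j).
    have xE j : x j ord0 = y j :> nat.
      by have [_ yj] := bounded _ j yb; rewrite mxE inordK.
    have xA : x \in A by rewrite AE (eq_is_solution _ xE).
    by exists x => //; apply/ffunP=> j; apply: val_inj; rewrite /= fE // xE.
  by rewrite (@eq_is_solution _ _ (fun j => x j ord0)) -?AE // => j; rewrite fE.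
rewrite card_in_imset // => x y xA yA fxy.
apply/matrixP=> j k; rewrite (ord1 k); apply: val_inj.
by rewrite /= -fE // fxy fE.
Qed.

Definition even_perimeters x : bool := [forall i, ~~ odd (perimeter x i)].

Lemma even_perimeters_parities x :
  even_perimeters x = even_perimeters (fun j => parities x j).
Proof.
apply: eq_forallb => i; congr (~~ _); rewrite /perimeter.
rewrite !(big_morph odd oddD (erefl _)); apply: eq_bigr => j _.
by rewrite !oddM ffunE oddb.
Qed.

(** Positive edge lengths x with even boundary lengths solve the system for
    exactly one c, namely half of the boundary lengths, and the entries of this c
    have the same sum as those of x. *)
Lemma sum_even_solutions K k x : (k < K)%N ->
  (\sum_(c : {ffun 'I_n -> 'I_K} | (\sum_i c i)%N == k)
     [forall i, (0 < c i)%N] * is_solution (\col_i (c i).*2) x =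
   ((\sum_j x j)%N == k) * ([forall j, (0 < x j)%N] && even_perimeters x))%N.
Proof.
move=> kK.
case: (boolP ([forall j, (0 < x j)%N] && even_perimeters x)) => [|not_ev].
  case/andP=> /forallP x_gt0 /forallP x_even.
  have half_perimeter i : ((perimeter x i)./2.*2 = perimeter x i)%N.
    by rewrite -[RHS]odd_double_half (negPf (x_even i)).
  have sum_half : (\sum_i (perimeter x i)./2 = \sum_j x j)%N.
    apply: double_inj; rewrite -sum_perimeter -!mul2n big_distrr /=.
    by apply: eq_bigr => i _; rewrite mul2n half_perimeter.
  have solE (c : {ffun 'I_n -> 'I_K}) : is_solution (\col_i (c i).*2) x ->
      forall i, c i = (perimeter x i)./2 :> nat.
    by case/andP=> _ /forallP xc i; rewrite (eqP (xc i)) mxE doubleK.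
  rewrite muln1; have [sx | sx] := altP eqP; last first.
    rewrite big1 // => c /eqP sc; case: (boolP (is_solution _ x)) => [xc|_].
      by case/eqP: sx; rewrite -sum_half -sc; apply: eq_bigr => i _; rewrite solE.
    by rewrite muln0.
  have bounded i : ((perimeter x i)./2 < K)%N.
    by apply: leq_ltn_trans kK; rewrite -sx -sum_half (bigD1 i) //= leq_addr.
  pose c0 : {ffun 'I_n -> 'I_K} := [ffun i => Ordinal (bounded i)].
  have c0E i : c0 i = (perimeter x i)./2 :> nat by rewrite ffunE.
  rewrite (bigD1 c0) /=; last by rewrite -sx -sum_half; under eq_bigr do rewrite c0E.
  rewrite big1 ?addn0 => [|c /andP[_ c_neq]].
    have -> : [forall i, (0 < c0 i)%N].
      apply/forallP=> i; rewrite c0E -double_gt0 half_perimeter.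
      exact: perimeter_gt0.
    suff -> : is_solution (\col_i (c0 i).*2) x by [].
    by apply/andP; split; apply/forallP=> // i; rewrite mxE c0E half_perimeter.
  case: (boolP (is_solution _ x)) => [xc|_]; last by rewrite muln0.
  case/eqP: c_neq; apply/ffunP=> i; apply: val_inj.
  by rewrite /= (solE _ xc) c0E.
rewrite muln0 big1 // => c _; case: (boolP (is_solution _ x)); rewrite ?muln0 //.
case/andP=> x_gt0 /forallP xc; case/negP: not_ev; rewrite x_gt0.
by apply/forallP=> i; rewrite (eqP (xc i)) mxE odd_double.
Qed.

(** Count the pairs (c, x) with A_G x = 2 c by x instead of by c. *)
Lemma N_fatgraph_series (R : fieldType) K : 'X^K %|
  lattice_sum (fun x => ([forall j, (0 < x j)%N] && even_perimeters x)%:R) K -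
  lattice_sum (fun c : 'I_n -> nat => [forall i, (0 < c i)%N]%:R *
    (N_fatgraph G (\col_i (c i).*2))%:R : R) K.
Proof.
apply/dvd_XnP=> k kK; rewrite coefB !coef_lattice_sum; apply/eqP.
rewrite subr_eq0; apply/eqP; rewrite -natr_sum.
transitivity ((\sum_(c : {ffun 'I_n -> 'I_K} | (\sum_i c i)%N == k)
  [forall i, (0 < c i)%N] * N_fatgraph G (\col_i (c i).*2))%:R : R)%N; last first.
  by rewrite natr_sum; apply: eq_bigr => c _; rewrite natrM.
congr (_%:R); rewrite big_mkcond /=.
transitivity (\sum_(x : {ffun edge_of -> 'I_K})
  \sum_(c : {ffun 'I_n -> 'I_K} | (\sum_i c i)%N == k)
     [forall i, (0 < c i)%N] * is_solution (\col_i (c i).*2) (fun j => x j))%N.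
  apply: eq_bigr => x _; rewrite sum_even_solutions //.
  by case: ifP; rewrite ?mul1n ?mul0n.
rewrite exchange_big; apply: eq_bigr => c /eqP sc.
rewrite -big_distrr (@N_fatgraphE _ K); last first.
  under eq_bigr do rewrite mxE -mul2n; by rewrite -big_distrr /= sc mul2n ltn_double.
congr (_ * _)%N; rewrite -[RHS]sum1_card [RHS]big_mkcond /=; apply: eq_bigr => x _.
by rewrite inE; case: is_solution.
Qed.

(** Evenness of the boundary lengths is a condition on the parities of the edge
    lengths, and it holds for the zero vector of parities. *)
Lemma N_fatgraph_value (R : fieldType) : value_at_infinity
  (lattice_sum (fun c : 'I_n -> nat => [forall i, (0 < c i)%N]%:R *
    (N_fatgraph G (\col_i (c i).*2))%:R)) ((-1) ^+ #|edges G| : R).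
Proof.
apply: eq_value_at_infinity (N_fatgraph_series R) _.
rewrite -[in X in _ ^+ X](card_ord #|edges G|).
pose Q (y : {ffun edge_of -> bool}) := even_perimeters (fun j => y j).
have := @lattice_value_parity R _ Q.
have -> : Q [ffun=> false].
  apply/forallP=> i; rewrite /perimeter big1 // => j _.
  by rewrite ffunE muln0.
move=> /(_ isT); apply: eq_value_at_infinity => K.
rewrite (eq_lattice_sum _ (w' := fun x =>
  ([forall j, (0 < x j)%N] && even_perimeters x)%:R)) ?subrr ?dvdp0 // => x.
by rewrite even_perimeters_parities.
Qed.

End Perimeters.

(** * The value at 0 and the Euler characteristic *)

Theorem theorem2 (g n : nat) (hn : (1 <= n)%N) (hgn : (2 < 2 * g + n)%N)
    (p : {mpoly rat[n]})
    (hp : forall b : 'cV[nat]_n,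
        (forall i, (0 < b i ord0)%N && ~~ odd (b i ord0)) ->
        p.@[fun i => (b i ord0)%:R] = N_moduli g b) :
  p.@[fun _ => 0] = chi_moduli g n.
Proof.
suff : (-1) ^+ n * p.@[fun _ => 0] = sum_Fat g (fun m (G : lfatgraph 'I_m n) =>
    #|lfg_aut G|%:R^-1 * (-1) ^+ #|edges G|) :> rat.
  move/(congr1 ( *%R ((-1) ^+ n))); rewrite signrMK => ->.
  rewrite /chi_moduli /sum_Fat mulr_sumr; apply: eq_bigr => m _.
  rewrite mulr_sumr; apply: eq_bigr => G _.
  rewrite expfzDr ?oppr_eq0 ?oner_neq0 // -invr_expz /= -!exprnP invr_sign.
  by rewrite mulrCA mulrC (mulrC (_ ^+ n)).
apply: value_at_infinity_unique (lattice_value_polynomial p) _.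
apply: (eq_value_at_infinity (F := fun K =>
  \sum_(m < 12 * g + 6 * n) \sum_(G in Fat g n m) #|lfg_aut G|%:R^-1 *:
    lattice_sum (fun c : 'I_n -> nat => [forall i, (0 < c i)%N]%:R *
      (N_fatgraph G (\col_i (c i).*2))%:R) K)) => [K |]; last first.
  apply: value_at_infinity_sum => m _; apply: value_at_infinity_sum => G _.
  by apply: value_at_infinityZ; apply: N_fatgraph_value.
under eq_bigr do rewrite -lattice_sum_sum.
under eq_bigr do rewrite -[lattice_sum _ _]scale1r.
rewrite -lattice_sum_sum (eq_lattice_sum _ (w' := (fun c : 'I_n -> nat =>
       [forall i, (0 < c i)%N]%:R * p.@[fun i => (c i).*2%:R])))
  ?subrr ?dvdp0 //.
move=> c; case: (boolP [forall i, _]) => [/forallP c_gt0|_]; last first.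
  rewrite mul0r big1 // => m _; rewrite mul1r big1 // => G _.
  by rewrite mul0r mulr0.
have := hp (\col_i (c i).*2).
rewrite mul1r (@meval_eq _ _ _ (fun i => (c i).*2%:R)); last first.
  by move=> i; rewrite mxE.
move=> -> => [|i]; last by rewrite mxE odd_double double_gt0 c_gt0.
apply: eq_bigr => m _; rewrite mul1r; apply: eq_bigr => G _.
by rewrite mul1r mulrC.
Qed.
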